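(* Assume $\mathrm{MA}_{\omega_1}$ (Martin's Axiom for $\omega_1$ dense sets). Then for every ordinal $\alpha<\omega_2$ we have $\Pi^*_\alpha\neq\Sigma^*_\alpha$, i.e. the hierarchy of $\omega_1$-Borel subsets of $2^\omega$ has length $\omega_2$.
   Context: The $\omega_1$-Borel hierarchy of subsets of $2^\omega$ is defined by: $\Sigma^*_0=\Pi^*_0=$ the clopen subsets of $2^\omega$; for $\alpha>0$, $\Sigma^*_\alpha$ is the family of all unions $\bigcup_{\beta<\omega_1}A_\beta$ where each $A_\beta\in\bigcup_{\gamma<\alpha}\Pi^*_\gamma$, and $\Pi^*_\alpha$ is the family of all intersections $\bigcap_{\beta<\omega_1}A_\beta$ where each $A_\beta\in\bigcup_{\gamma<\alpha}\Sigma^*_\gamma$. The $\omega_1$-Borel sets are the sets in $\bigcup_{\alpha}\Sigma^*_\alpha$ (the smallest family containing the open sets and closed under unions and intersections of size $\omega_1$). The length of the hierarchy is the least $\alpha\ge1$ with $\Pi^*_\alpha=\Sigma^*_\alpha$.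
   Formalization: The inequality of the two classes is stated for 1 ≤ α < ω_2: at α = 0 it fails, since both classes are by definition the clopen sets; this agrees with the length being the least α ≥ 1. *)

(* Defs.v *)
From mathcomp Require Import all_boot all_order.
From mathcomp Require Import all_classical wochoice.
From mathcomp Require Import topology cantor.

Set Implicit Arguments.
Unset Strict Implicit.
Unset Printing Implicit Defensive.

Local Open Scope classical_set_scope.
Local Open Scope card_scope.

(* An ordinal is represented by any well-ordered type of that order type, the
   order being the reflexive one; equality of ordinals is isomorphism [oeq]. *)
Record Ord : Type := MkOrd {
  ocarrier :> Type;
  orel : rel ocarrier;
  orelP : well_order orel
}.

Definition oembedding (a b : Ord) (f : a -> b) : Prop :=
  forall x y : a, orel (f x) (f y) = orel x y.

Definition oeq (a b : Ord) : Prop :=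
  exists f : a -> b, oembedding f /\ range f = [set: b].

Definition oinitial (b : Ord) (z : b) : set b :=
  [set y | orel y z /\ y <> z].

Definition olt (a b : Ord) : Prop :=
  exists (f : a -> b) (z : b), oembedding f /\ range f = oinitial z.

Definition ole (a b : Ord) : Prop := olt a b \/ oeq a b.

(* [a] is the least ordinal that does not inject into [X].  Order types are
   well-founded and totally ordered by [olt], so this determines [a] up to
   [oeq]. *)
Definition least_not_injecting (X : Type) (a : Ord) : Prop :=
  ~ ([set: a] #<= [set: X]) /\
  forall b : Ord, olt b a -> [set: b] #<= [set: X].

Section WellOrder.
Context (T : Type) (R : rel T).
Context (wR : well_order R).

Let wc : @wo_chain {classic T} R predT.
Proof. by move=> A _; exact: wR. Qed.

Lemma wo_refl x : R x x.
Proof. exact: (wo_chain_reflexive wc). Qed.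

Lemma wo_anti x y : R x y -> R y x -> x = y.
Proof.
by move=> xy yx; apply: (wo_chain_antisymmetric wc) => //; rewrite xy yx.
Qed.

Lemma wo_min (A : set T) : A !=set0 ->
  exists2 m, A m & forall x, A x -> R m x.
Proof.
move=> [x Ax]; have [|m [[mA mP] _]] := wR (A := [pred u | `[< A u >]]).
  by exists x; apply/asboolP.
exists m; first exact/asboolP.
by move=> y Ay; apply: mP; apply/asboolP.
Qed.

Lemma wo_trans : transitive R.
Proof.
move=> y x z xy yz.
have [|m mA mP] := @wo_min [set u | [\/ u = x, u = y | u = z]].
  by exists x; constructor 1.
have mx : R m x by apply: mP; constructor 1.
have my : R m y by apply: mP; constructor 2.
have mz : R m z by apply: mP; constructor 3.
case: mA => e; subst m => //; first by rewrite (wo_anti xy mx).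
by rewrite -(wo_anti yz my).
Qed.

End WellOrder.

Lemma oembedding_inj (a b : Ord) (f : a -> b) :
  oembedding f -> injective f.
Proof.
move=> fe x y fxy; apply: (wo_anti (@orelP a)).
  by rewrite -fe fxy; exact: wo_refl (@orelP b) _.
by rewrite -fe fxy; exact: wo_refl (@orelP b) _.
Qed.

Lemma olt_card_le (a b : Ord) (f : a -> b) (z : b) :
  oembedding f -> range f = oinitial z -> [set: a] #<= oinitial z.
Proof.
move=> fe <-; have := @inj_card_eq _ _ [set: a] f.
move=> /(_ (in2W (oembedding_inj fe))).
by rewrite card_eq_sym card_eq_le => /andP[].
Qed.

Lemma least_not_injecting_ex (X : Type) :
  exists a : Ord, least_not_injecting X a.
Proof.
have [R wR] := well_ordering_principle {classic (set X)}.
pose W := MkOrd wR.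
have [allle|/existsNP nle] :=
    pselect (forall z : W, oinitial z #<= [set: X]).
  exists W; split; last first.
    move=> b [f [z [fe fz]]].
    exact: card_le_trans (olt_card_le fe fz) (allle z).
  move=> /card_leP/unsquash g.
  pose f (S : set X) : X := val (g (to_setT (S : W))).
  have fi : injective f.
    move=> S S' /val_inj e.
    suff: to_setT (S : W) = to_setT (S' : W) by move/(congr1 val).
    by apply: (@inj _ _ setT g) => //; rewrite in_setT.
  pose D : set X := [set x | exists S : set X, f S = x /\ ~ S x].
  have [DfD|nDfD] := pselect (D (f D)).
    by case: (DfD) => S [/fi eS]; rewrite eS.
  by apply: (nDfD); exists D.
have [z nz zmin] := wo_min (orelP (o := W)) nle.
pose T := {y : W | oinitial z y}.
have svalI : injective (fun u : T => sval u).
  by move=> [u pu] [v pv] /= e; exact: eq_exist.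
pose RT : rel T := fun u v => R (sval u) (sval v).
have wRT : well_order RT.
  apply: antisymmetric_well_order.
    move=> u v /andP[uv vu]; apply: svalI; exact: (wo_anti wR uv vu).
  move=> A [u uA].
  have [|m [v vA vm] mP] :=
      wo_min wR (A := [set y | exists2 v, v \in A & sval v = y]).
    by exists (sval u), u.
  exists v; split=> // t tA; rewrite /RT vm.
  by apply: mP; exists t.
exists (MkOrd wRT); split.
  move=> TX; apply: nz; apply: card_le_trans TX.
  have -> : oinitial z = range (fun u : T => sval u).
    by rewrite predeqE => y; split=> [yz|[[t tz] _ <-//]]; exists (exist _ y yz).
  exact: card_image_le.
move=> b [f [u [fe fu]]].
pose g : b -> W := fun x => sval (f x).
have ge : @oembedding b W g by move=> x y; rewrite -fe.
have gu : range g = @oinitial W (sval u).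
  rewrite predeqE => y; split=> [[x _ <-]|[yu nyu]].
    have : range f (f x) by exists x.
    rewrite fu => -[xu nxu]; split=> // e; apply: nxu; exact: svalI.
  have yz : oinitial z y.
    have [uz nuz] := svalP u; split; first exact: (wo_trans wR yu uz).
    by move=> e; apply: nuz; apply: (wo_anti wR uz); move: yu; rewrite e.
  have : @oinitial (MkOrd wRT) u (exist _ y yz).
    by split=> // e; exact: (nyu (congr1 (fun v : T => sval v) e)).
  by rewrite -fu => -[x _ fx]; exists x; rewrite // /g fx.
have [uz nuz] := svalP u.
apply: card_le_trans (olt_card_le ge gu) _.
apply: contrapT => nu; apply: nuz; apply: (wo_anti wR uz); exact: zmin.
Qed.

(* A representative, obtained by choice, of the least ordinal that does not
   inject into [X]; in particular [hartogs nat] has order type omega_1. *)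
Definition hartogs (X : Type) : Ord := sval (cid (least_not_injecting_ex X)).

Lemma hartogsP (X : Type) : least_not_injecting X (hartogs X).
Proof. exact: svalP. Qed.

Definition omega1 : Ord := hartogs nat.

Definition omega2 : Ord := hartogs omega1.

Definition forcing_compatible (P : Type) (le : rel P) (p q : P) : Prop :=
  exists r, le r p /\ le r q.

Definition ccc (P : Type) (le : rel P) : Prop :=
  forall A : set P,
    (forall p q, A p -> A q -> p <> q -> ~ forcing_compatible le p q) ->
    countable A.

Definition forcing_dense (P : Type) (le : rel P) (D : set P) : Prop :=
  forall p, exists2 d, D d & le d p.

Definition forcing_filter (P : Type) (le : rel P) (G : set P) : Prop :=
  [/\ G !=set0,
      (forall p q, G p -> le p q -> G q) &
      (forall p q, G p -> G q -> exists r, [/\ G r, le r p & le r q])].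

Definition MA_omega1 : Prop :=
  forall (P : Type) (le : rel P),
    inhabited P -> partial_order le -> ccc le ->
    forall D : omega1 -> set P, (forall i, forcing_dense le (D i)) ->
    exists2 G, forcing_filter le G & forall i, G `&` D i !=set0.

(* [inhabited a] says that the ordinal [a] is nonzero.  Since [olt] is
   well-founded, these inductive clauses amount to a definition by recursion. *)
Inductive Sigma_star : Ord -> set (set cantor_space) :=
| Sigma_star_zero (a : Ord) (A : set cantor_space) :
    ~ inhabited a -> clopen A -> Sigma_star a A
| Sigma_star_bigcup (a : Ord) (A : omega1 -> set cantor_space) :
    inhabited a ->
    (forall i, exists2 c, olt c a & Pi_star c (A i)) ->
    Sigma_star a (\bigcup_i A i)
with Pi_star : Ord -> set (set cantor_space) :=
| Pi_star_zero (a : Ord) (A : set cantor_space) :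
    ~ inhabited a -> clopen A -> Pi_star a A
| Pi_star_bigcap (a : Ord) (A : omega1 -> set cantor_space) :
    inhabited a ->
    (forall i, exists2 c, olt c a & Sigma_star c (A i)) ->
    Pi_star a (\bigcap_i A i).

Definition hierarchy_length (l : Ord) : Prop :=
  [/\ inhabited l, Pi_star l = Sigma_star l &
      forall a : Ord, inhabited a -> Pi_star a = Sigma_star a -> ole l a].

(* Main.v *)
Require Import Defs.
From mathcomp Require Import all_boot all_order.
From mathcomp Require Import all_classical wochoice.
From mathcomp Require Import topology cantor.

(* Suppose Pi*_a = Sigma*_a =: F for some 0 < a < omega2.  Then F contains the
   clopen sets and is closed under complements and unions of size omega1.
   Almost disjoint forcing gives Borel sets H_k (k < omega1) such that every
   subset of omega1 is {k | x in H_k} for some real x; hence a real codes a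
   labelling of the omega1 leaves of the well-founded tree that generates all
   Pi*_a sets, and the resulting universal set has its diagonal in F, against
   Cantor's argument.  No computation of the level of the universal set is
   needed, since F already is the class of all omega1-Borel sets.  At omega2
   itself the classes agree because omega1 ordinals below omega2 are bounded
   below omega2. *)

Set Implicit Arguments.
Unset Strict Implicit.
Unset Printing Implicit Defensive.

Local Open Scope classical_set_scope.
Local Open Scope card_scope.

(** * Well-orders, initial segments and comparability of ordinals *)

Lemma wo_total (T : Type) (R : rel T) (wR : well_order R) : total R.
Proof.
move=> x y; have [|m mxy mP] := @wo_min _ _ wR [set u | u = x \/ u = y].
  by exists x; left.
by case: mxy => e; subst m; apply/orP; [left|right]; apply: mP; [right|left].
Qed.

Lemma oinitialNge (a : Ord) (x y : a) : ~ orel y x <-> oinitial y x.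
Proof.
split=> [nyx|[xy nxy] yx]; last exact/nxy/(wo_anti (@orelP a) xy yx).
have := wo_total (@orelP a) x y; case/orP=> [xy|//].
by split=> // e; apply: nyx; rewrite e; exact: (wo_refl (@orelP a)).
Qed.

Lemma oinitial_total (a : Ord) (x y : a) : x <> y -> oinitial y x \/ oinitial x y.
Proof.
move=> nxy; case/orP: (wo_total (@orelP a) x y) => ?; [left|right]; split=> //.
by move=> /esym.
Qed.

Lemma oinitial_ind (a : Ord) (P : a -> Prop) :
  (forall y, (forall x, oinitial y x -> P x) -> P y) -> forall y, P y.
Proof.
move=> IH; apply: contrapT => /existsNP ne.
have [m nPm mP] := wo_min (@orelP a) ne.
apply: nPm; apply: IH => x /oinitialNge nmx; apply: contrapT => nPx.
exact/nmx/mP.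
Qed.

Lemma oinitial_trans (a : Ord) (x y z : a) :
  oinitial y x -> oinitial z y -> oinitial z x.
Proof.
move=> [xy nxy] [yz nyz]; split; first exact: (wo_trans (@orelP a) xy yz).
by move=> e; apply: nyz; apply: (wo_anti (@orelP a) yz); rewrite -e.
Qed.

Lemma strict_oembedding (a b : Ord) (f : a -> b) :
  (forall x y, oinitial y x -> oinitial (f y) (f x)) -> oembedding f.
Proof.
move=> fP x y; apply/idP/idP => [fxy|xy].
  by apply: contrapT => /oinitialNge/fP/oinitialNge; apply.
have [->|nxy] := pselect (x = y); first exact: (wo_refl (@orelP b)).
by have [] : oinitial (f y) (f x) by exact: fP.
Qed.

Lemma oembedding_oinitial (a b : Ord) (f : a -> b) x y :
  oembedding f -> oinitial (f y) (f x) <-> oinitial y x.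
Proof.
move=> fe; rewrite /oinitial /= fe; split=> -[xy n]; split=> //.
  by move=> e; apply: n; rewrite e.
by move/(oembedding_inj fe).
Qed.

(* Two points are related when the segments below them are isomorphic. *)
Inductive same_height (a b : Ord) : a -> b -> Prop :=
| Same_height x y :
    (forall x', oinitial x x' -> exists2 y', oinitial y y' & same_height x' y') ->
    (forall y', oinitial y y' -> exists2 x', oinitial x x' & same_height x' y') ->
    same_height x y.

Lemma same_heightP (a b : Ord) (x : a) (y : b) : same_height x y ->
  (forall x', oinitial x x' -> exists2 y', oinitial y y' & same_height x' y') /\
  (forall y', oinitial y y' -> exists2 x', oinitial x x' & same_height x' y').
Proof. by case. Qed.

Lemma same_height_sym (a b : Ord) (x : a) (y : b) :
  same_height x y -> same_height y x.
Proof.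
move: y; elim/oinitial_ind: x => x IH y /same_heightP[H1 H2].
constructor.
  by move=> y' /H2[x' xx' h]; exists x' => //; exact: IH.
by move=> x' xx'; have [y' yy' h] := H1 _ xx'; exists y' => //; exact: IH.
Qed.

Lemma same_height_inj (a b : Ord) (x : a) (y z : b) :
  same_height x y -> same_height x z -> y = z.
Proof.
move: y z; elim/oinitial_ind: x => x IH.
suff H (y z : b) : same_height x y -> same_height x z -> ~ oinitial z y.
  move=> y z xy xz; apply: contrapT => /oinitial_total[]; exact: H.
move=> /same_heightP[H1 _] /same_heightP[_ H2] zy.
have [x' xx' h] := H2 _ zy; have [y' [_ nyy'] h'] := H1 _ xx'.
by apply: nyy'; rewrite (IH _ xx' _ _ h h').
Qed.

Lemma same_height_mono (a b : Ord) (x x' : a) (y y' : b) :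
  same_height x y -> same_height x' y' -> oinitial x x' -> oinitial y y'.
Proof.
move=> /same_heightP[H1 _] xy' xx'.
by have [y'' yy'' h] := H1 _ xx'; rewrite (same_height_inj xy' h).
Qed.

(** The points of [a] having a partner in [b] are closed downwards, so they are all of [a] or the
    segment below the least point without a partner. *)
Lemma same_height_total_or (a b : Ord) :
  (forall x : a, exists y : b, same_height x y) \/
  exists2 x : a, ~ (exists y : b, same_height x y) &
    forall x', (exists y : b, same_height x' y) <-> oinitial x x'.
Proof.
have [|/existsNP ne] := pselect (forall x : a, exists y : b, same_height x y).
  by left.
right; have [x nPx xP] := wo_min (@orelP a) ne; exists x => // x'; split.
  move=> [y h]; apply/oinitialNge => xx'; apply: nPx.
  have [->|nxx'] := pselect (x = x'); first by exists y.
  have /same_heightP[H1 _] := h.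
  by have [y' _ h'] := H1 x (conj xx' nxx'); exists y'.
by move=> /oinitialNge nxx'; apply: contrapT => n; apply/nxx'/xP.
Qed.

Lemma same_height_oembedding (a b : Ord) :
  (forall x : a, exists y : b, same_height x y) ->
  exists2 f : a -> b, oembedding f & range f = [set y | exists x : a, same_height y x].
Proof.
move=> /choice[f fP]; exists f.
  by apply: strict_oembedding => x y; exact: same_height_mono.
rewrite predeqE => y; split=> [[x _ <-]|[x /same_height_sym xy]].
  by exists x; exact: same_height_sym.
by exists x => //; exact: same_height_inj (fP x) xy.
Qed.

Lemma same_height_ole (a b : Ord) :
  (forall x : a, exists y : b, same_height x y) -> ole a b.
Proof.
move=> /same_height_oembedding[f fe fr].
have [tot|[y _ yP]] := same_height_total_or b a; [right; exists f|left; exists f, y].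
  by split=> //; rewrite fr predeqE => y; split=> // _; exact: tot.
by split=> //; rewrite fr predeqE.
Qed.

(** If both orders had points without a partner, the least such points [x] and [y] would have
    matching segments below them, hence the same height. *)
Lemma olt_or_ole (a b : Ord) : olt a b \/ ole b a.
Proof.
have [/same_height_ole|[y nPy yP]] := same_height_total_or b a; first by right.
left; have [tot|[x nPx xP]] := same_height_total_or a b.
  have [f fe fr] := same_height_oembedding tot.
  by exists f, y; split=> //; rewrite fr predeqE.
case: nPx; exists y; constructor=> [x' /xP[y' h]|y' /yP[x' h]].
  by exists y' => //; apply/yP; exists x'; exact: same_height_sym.
exists x'; last exact: same_height_sym.
by apply/xP; exists y'; exact: same_height_sym.
Qed.

Section SubOrd.
Context (a : Ord) (z : a).

Definition osegment_rel : rel {y : a | oinitial z y} :=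
  fun u v => orel (sval u) (sval v).

Lemma osegment_relP : well_order osegment_rel.
Proof.
have svalI : injective (fun u : {y : a | oinitial z y} => sval u).
  by move=> [u pu] [v pv] /= e; exact: eq_exist.
apply: antisymmetric_well_order.
  by move=> u v /andP[uv vu]; apply: svalI; exact: (wo_anti (@orelP a) uv vu).
move=> A [u uA].
have [|m [v vA vm] mP] :=
    wo_min (@orelP a) (A := [set y | exists2 v, v \in A & sval v = y]).
  by exists (sval u), u.
exists v; split=> // t tA; rewrite /osegment_rel vm.
by apply: mP; exists t.
Qed.

Definition osegment : Ord := MkOrd osegment_relP.

Lemma osegmentP : oembedding (fun u : osegment => sval u) /\
  range (fun u : osegment => sval u) = oinitial z.
Proof.
split=> //; rewrite predeqE => y; split=> [[[t tz] _ <-//]|yz].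
by exists (exist _ y yz).
Qed.

Lemma osegment_olt : olt osegment a.
Proof. by exists (fun u : osegment => sval u), z; exact: osegmentP. Qed.

End SubOrd.

(** * Cardinal arithmetic at omega1 *)

Lemma oinitial_hartogs (X : Type) (z : hartogs X) : oinitial z #<= [set: X].
Proof.
have [_ H] := hartogsP X; apply: card_le_trans (H _ (osegment_olt z)).
by rewrite -(osegmentP z).2; exact: card_image_le.
Qed.

Lemma card_leTT (X Y : Type) :
  [set: X] #<= [set: Y] <-> exists f : X -> Y, injective f.
Proof.
split=> [/card_leP/unsquash g|[f fi]].
  exists (fun x => val (g (to_setT x))) => x y /val_inj e.
  suff: to_setT x = to_setT y by move/(congr1 val).
  by apply: (@inj _ _ setT g) => //; rewrite in_setT.
apply: card_le_trans (card_leT (range f)).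
by have := @inj_card_eq _ _ [set: X] f (in2W fi); rewrite card_eq_sym card_eq_le => /andP[].
Qed.

Definition small (X : Type) : Prop := exists f : X -> omega1, injective f.

Lemma small_inj (X Y : Type) (f : X -> Y) : injective f -> small Y -> small X.
Proof. by move=> fi [g gi]; exists (g \o f); exact: inj_comp. Qed.

Lemma omega1_uncountable : ~ countable [set: omega1].
Proof. exact: (hartogsP nat).1. Qed.

Lemma countable_oinitial_eq (y : omega1) : countable [set x : omega1 | orel x y].
Proof.
have /countable_injP[f fi] := oinitial_hartogs y.
(* The shift by one frees the value 0 for the endpoint [y]. *)
apply/countable_injP; exists (fun x => if `[< x = y >] then 0 else (f x).+1).
move=> x x' /set_mem /= xy /set_mem /= x'y.
case: asboolP => [->|nx]; case: asboolP => [->|nx'] //= [] /fi.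
by apply; apply/mem_set.
Qed.

(** Order [X] by [h] first and by an arbitrary well-order on the fibres. Proper initial segments are
    then countable, so omega1 is not one of them and the order type is at most omega1. *)
Lemma small_of_countable_below (X : Type) (h : X -> omega1) :
  (forall y, countable [set x | orel (h x) y]) -> small X.
Proof.
move=> hc; have [R0 wR0] := well_ordering_principle {classic X}.
pose R : rel X := fun x y => `[< oinitial (h y) (h x) \/ h x = h y /\ R0 x y >].
have wR : well_order R.
  apply: antisymmetric_well_order.
    move=> x y /andP[/asboolP xy /asboolP yx].
    have irr (z : omega1) : ~ oinitial z z by move=> [_]; apply.
    case: xy => [lt|[e xy]]; case: yx => [lt'|[e' yx]].
    - by case: (irr (h x)); exact: oinitial_trans lt lt'.
    - by move: lt; rewrite e' => /irr.
    - by move: lt'; rewrite e => /irr.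
    - exact: (wo_anti wR0).
  move=> A [x0 x0A].
  have [|y [x1 [x1A hx1]] yP] :=
      wo_min (@orelP omega1) (A := [set y | exists x, x \in A /\ h x = y]).
    by exists (h x0), x0.
  have [|x [xA hx] xP] := wo_min wR0 (A := [set x | x \in A /\ h x = y]).
    by exists x1.
  exists x; split=> // t tA; apply/asboolP.
  have yt : orel y (h t) by apply: yP; exists t.
  have [e|ne] := pselect (h t = y); last by left; split; rewrite hx // => /esym.
  by right; rewrite hx e; split=> //; exact: xP.
have [[f [x [fe fx]]]|H] := olt_or_ole omega1 (MkOrd wR).
  case: omega1_uncountable; apply: card_le_trans (hc (h x)).
  apply: card_le_trans (olt_card_le fe fx) _.
  apply: subset_card_le => t [/asboolP[[xt _] _ //|[e _] _]]; rewrite /= e.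
  exact: (wo_refl (@orelP omega1)).
by case: H => [[f [y [fe _]]]|[f [fe _]]]; exists f; exact: oembedding_inj fe.
Qed.

Lemma small_omega1 : small omega1.
Proof. by exists id. Qed.

Lemma omega1_prod : small (omega1 * omega1).
Proof.
(* The larger coordinate: only countably many pairs have both coordinates below a given point. *)
pose h (p : omega1 * omega1) := if orel p.1 p.2 then p.2 else p.1.
apply: (@small_of_countable_below _ h) => y.
apply: (@sub_countable _ _ _ ([set x : omega1 | orel x y] `*` [set x : omega1 | orel x y])).
  apply: subset_card_le => -[u v]; rewrite /h /=.
  case: ifP => [uv vy|/negP/oinitialNge[vu _] uy]; split=> //.
    exact: (wo_trans (@orelP omega1) uv).
  exact: (wo_trans (@orelP omega1) vu).
by apply: countableX; exact: countable_oinitial_eq.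
Qed.

Lemma small_prod (X Y : Type) : small X -> small Y -> small (X * Y).
Proof.
move=> [f fi] [g gi]; apply: (@small_inj _ _ (fun p : X * Y => (f p.1, g p.2))); last exact: omega1_prod.
by move=> [x y] [x' y'] /= [/fi-> /gi->].
Qed.

Lemma small_nat : small nat.
Proof.
apply/card_leTT/infiniteP => /finite_set_countable; exact: omega1_uncountable.
Qed.

Lemma small_countType (X : countType) : small X.
Proof. apply: (@small_inj _ _ pickle _ small_nat); exact: pcan_inj (@pickleK X). Qed.

Lemma small_sum (X Y : Type) : small X -> small Y -> small (X + Y).
Proof.
move=> [f fi] [g gi]; pose h (u : X + Y) := match u with inl x => (true, f x) | inr y => (false, g y) end.
apply: (@small_inj _ _ h).
  by move=> [x|x] [y|y] //= [] => [/fi->|/gi->].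
exact: small_prod (small_countType bool) small_omega1.
Qed.

(** A well-order of [set nat] shorter than omega1 would be countable, against Cantor's diagonal
    set. *)
Lemma omega1_inj_sets : exists f : omega1 -> set nat, injective f.
Proof.
have [R wR] := well_ordering_principle {classic (set nat)}.
have [[f [x [fe fx]]]|H] := olt_or_ole (MkOrd wR) omega1; last first.
  by case: H => [[f [y [fe _]]]|[f [fe _]]]; exists f; exact: oembedding_inj fe.
have /card_leTT[g gi] : [set: set nat] #<= [set: nat].
  exact: card_le_trans (olt_card_le fe fx) (oinitial_hartogs x).
pose D : set nat := [set n | exists S : set nat, g S = n /\ ~ S n].
have [DgD|nDgD] := pselect (D (g D)); first by case: (DgD) => S [/gi eS]; rewrite eS.
by case: (nDgD); exists D.
Qed.

(** * Classes closed under complements and unions of size omega1 *)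

Definition omega1_algebra (F : set (set cantor_space)) : Prop :=
  [/\ (forall A, clopen A -> F A),
      (forall A, F A -> F (~` A)) &
      (forall A : omega1 -> set cantor_space,
         (forall i, F (A i)) -> F (\bigcup_i A i))].

Section Omega1Algebra.
Context (F : set (set cantor_space)) (FA : omega1_algebra F).

Lemma omega1_algebra_bigcup (J : Type) (A : J -> set cantor_space) :
  small J -> (forall j, F (A j)) -> F (\bigcup_j A j).
Proof.
have [Fclopen _ Fcup] := FA; move=> [f fi] AF.
(* The family is transported to omega1 along [f]; indices outside the range of [f] contribute the
   empty set. *)
have -> : \bigcup_j A j = \bigcup_i [set x | exists2 j, f j = i & A j x].
  rewrite predeqE => x; split=> [[j _ Ax]|[i _ [j _ Ax]]]; last by exists j.
  by exists (f j) => //; exists j.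
apply: Fcup => i; have [[j ji]|nj] := pselect (exists j, f j = i).
  suff -> : [set x | exists2 j, f j = i & A j x] = A j by [].
  rewrite predeqE => x; split=> [[j' ji' Ax]|Ax]; last by exists j.
  by rewrite (fi j j') // ji.
suff -> : [set x | exists2 j, f j = i & A j x] = set0 by apply: Fclopen; split; [exact: open0|exact: closed0].
by rewrite predeqE => x; split=> // -[j ji _]; apply: nj; exists j.
Qed.

Lemma omega1_algebra_bigcap (J : Type) (A : J -> set cantor_space) :
  small J -> (forall j, F (A j)) -> F (\bigcap_j A j).
Proof.
have [_ FC _] := FA; move=> Js AF.
rewrite -[X in F X]setCK setC_bigcap; apply/FC/omega1_algebra_bigcup => // j.
exact: FC.
Qed.

Lemma omega1_algebra_setI (A B : set cantor_space) : F A -> F B -> F (A `&` B).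
Proof.
move=> AF BF; have -> : A `&` B = \bigcap_b (if b then A else B).
  rewrite predeqE => x; split=> [[Ax Bx] [] //|ABx].
  by split; [exact: (ABx true)|exact: (ABx false)].
by apply: omega1_algebra_bigcap; [exact: small_countType|case].
Qed.

End Omega1Algebra.

(** * Clopen and open subsets of the Cantor space *)

Lemma clopen_coordinate (i : nat) : clopen [set x : cantor_space | x i].
Proof.
apply: (@preimage_clopen cantor_space bool (fun x => x i) [set b | b]).
  by split; [exact: discrete_open|exact: discrete_closed].
by exact: proj_continuous.
Qed.

(** Otherwise some sequence outside [A] agrees with [x] on longer and longer initial segments; it
    converges to [x], so it must enter [A]. *)
Lemma open_cylinder (A : set cantor_space) (x : cantor_space) :
  open A -> A x ->
  exists N, forall y : cantor_space, (forall i, i < N -> y i = x i) -> A y.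
Proof.
move=> oA Ax; apply: contrapT => nN.
have /choice[y yP] N : exists y : cantor_space, (forall i, i < N -> y i = x i) /\ ~ A y.
  apply: contrapT => ny; apply: nN; exists N => y yx.
  by apply: contrapT => nAy; apply: ny; exists y.
have cv : y @ \oo --> x.
  apply/cvg_sup => i.
  have sur : range (fun f : cantor_space => f i) = setT.
    by rewrite predeqE => b; split=> // _; exists (fun=> b).
  apply/cvg_image => // U Ux; exists ((fun f : cantor_space => f i) @^-1` U).
    exists i.+1 => // n /= lin; rewrite (yP n).1 //; exact: nbhs_singleton.
  by apply: image_preimage.
have [N _ /(_ N (leqnn N))] : \forall n \near \oo, A (y n).
  by apply: cv; apply: open_nbhs_nbhs.
exact: (yP N).2.
Qed.

(** * Almost disjoint coding under Martin's Axiom *)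

(** Binary notation, least significant bit first, closed by an extra top digit 1. This digit keeps
    trailing zeros visible, so the code determines the length, and it makes the code exceed the
    length. *)
Fixpoint code_bits (s : seq bool) : nat :=
  if s is b :: s' then b + (code_bits s').*2 else 1.

Lemma size_code_bits s : size s < code_bits s.
Proof.
elim: s => //= b s IH; rewrite -addnn; apply: ltn_addl.
by rewrite -(addn1 (size s).+1) leq_add //; exact: leq_ltn_trans IH.
Qed.

Lemma code_bits_inj : injective code_bits.
Proof.
have gt1 b s : code_bits (b :: s) <> 1.
  have := size_code_bits s; case: b => /=; case: (code_bits s) => //.
elim=> [|b s IH] [|b' s'] // => [/esym /gt1//|/gt1//|] /= e.
have eb : b = b' by have := congr1 odd e; rewrite !oddD !odd_double !addbF !oddb.
by move: e; rewrite eb => /addnI/double_inj/IH->.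
Qed.

Section AlmostDisjointCoding.
Context (f : omega1 -> set nat) (fI : injective f).

(* The almost disjoint family: [branch k] enumerates, in increasing length, the
   codes of the initial segments of the characteristic function of [f k]. *)
Definition branch (k : omega1) (n : nat) : nat :=
  code_bits (mkseq (fun i => `[< f k i >]) n).

Lemma branch_gt k n : n < branch k n.
Proof.
by have := size_code_bits (mkseq (fun i => `[< f k i >]) n); rewrite size_mkseq.
Qed.

(** Initial segments long enough to contain a place [i] where [f j] and [f k] differ have different
    codes. *)
Lemma branch_almost_disjoint j k :
  j <> k -> exists N, forall n n', N <= n -> branch k n <> branch j n'.
Proof.
move=> jk; have [i ni] : exists i, ~ (f k i <-> f j i).
  apply/existsNP => e; apply/jk/fI; rewrite predeqE => i.
  by split=> /(e i).
exists i.+1 => n n' lin /code_bits_inj e; apply: ni.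
have en : n = n' by have := congr1 size e; rewrite !size_mkseq.
have := congr1 (nth false ^~ i) e; rewrite -en !nth_mkseq // => ei.
by split=> /asboolP; [rewrite ei|rewrite -ei] => /asboolP.
Qed.

(** A G-delta set: the reals with infinite trace on the branch of [k]. *)
Definition hits (k : omega1) : set cantor_space :=
  \bigcap_m \bigcup_(n in [set n | m <= n]) [set x | x (branch k n)].

Lemma hits_omega1_algebra F k : omega1_algebra F -> F (hits k).
Proof.
move=> FA; apply: omega1_algebra_bigcap => //; first exact: small_nat.
move=> m; rewrite bigcup_mkcond.
apply: omega1_algebra_bigcup => //; first exact: small_nat.
move=> n; have [Fclopen _ _] := FA.
by case: ifP => _; apply: Fclopen; [exact: clopen_coordinate|exact: clopen0].
Qed.

Section Forcing.
Context (S : set omega1).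

(* A condition [(u, E)] decides the initial segment [u] of the real and
   promises to avoid, beyond [u], the branches with index in [E]. *)
Definition condition : Type :=
  (seq bool * {E : set omega1 | finite_set E /\ E `<=` ~` S})%type.

Definition stronger : rel condition := fun p q =>
  `[< [/\ prefix q.1 p.1, sval q.2 `<=` sval p.2 &
      forall i k n, size q.1 <= i -> nth false p.1 i -> sval q.2 k ->
        i <> branch k n] >].

Lemma nth_prefix (s t : seq bool) i : prefix s t -> nth false s i -> nth false t i.
Proof.
move=> /prefixP[r ->]; rewrite nth_cat; case: ltnP => // si.
by rewrite nth_default.
Qed.

Lemma prefix_nth (s t : seq bool) i :
  prefix s t -> i < size s -> nth false t i -> nth false s i.
Proof. by move=> /prefixP[r ->] si; rewrite nth_cat si. Qed.

Lemma stronger_partial_order : partial_order stronger.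
Proof.
split; first split.
- move=> p; apply/asboolP; split=> //; first exact: prefix_refl.
  by move=> i k n si; rewrite nth_default.
- move=> q p r /asboolP[pq1 pq2 pq3] /asboolP[qr1 qr2 qr3]; apply/asboolP; split.
  + exact: prefix_trans qr1 pq1.
  + exact: subset_trans qr2 pq2.
  + move=> i k n ri pi rk; have [qi|qi] := ltnP i (size q.1).
      by apply: qr3 => //; exact: prefix_nth pi.
    by apply: pq3 => //; exact: qr2.
- move=> [u [E hE]] [v [E' hE']] /andP[/asboolP[/= uv EE' _] /asboolP[/= vu E'E _]].
  congr (_, _).
    move: uv vu => /prefixP[r ->]; rewrite prefixE take_oversize ?size_cat ?leq_addr //.
    by move/eqP => <-.
  by apply: eq_exist; rewrite eqEsubset.
Qed.

(** Two conditions with the same bits are compatible, by uniting their promises, so an antichain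
    injects into the countable set of bit strings. *)
Lemma stronger_ccc : ccc stronger.
Proof.
move=> A Aanti; apply/countable_injP; exists (fun p => pickle p.1).
move=> p q /set_mem Ap /set_mem Aq /(pcan_inj (@pickleK _)) e.
apply: contrapT => npq; apply: (Aanti _ _ Ap Aq npq).
move: p q {Ap Aq npq} e => [u [E [hE ES]]] [v [E' [hE' ES']]] /= <-.
have hEE : finite_set (E `|` E') /\ E `|` E' `<=` ~` S.
  by split; [rewrite finite_setU|rewrite subUset].
exists (u, exist _ (E `|` E') hEE); split; apply/asboolP; split=> /=;
  by [exact: prefix_refl|move=> k; left|move=> k; right
     |move=> i k n ui; rewrite nth_default].
Qed.

Lemma dense_avoid k : ~ S k -> forcing_dense stronger [set p | sval p.2 k].
Proof.
move=> nSk [u [E [hE ES]]].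
have hk : finite_set (E `|` [set k]) /\ E `|` [set k] `<=` ~` S.
  split; first by rewrite finite_setU.
  by rewrite subUset; split=> // _ ->.
exists (u, exist _ (E `|` [set k]) hk); first by right.
apply/asboolP; split=> /=; first exact: prefix_refl.
  by move=> j; left.
by move=> i j n ui; rewrite nth_default.
Qed.

Lemma dense_hit k m : S k ->
  forcing_dense stronger [set p | exists2 n, m <= n & nth false p.1 (branch k n)].
Proof.
move=> Sk [u [E [hE ES]]].
(* The indices in [E] lie outside [S], hence differ from [k]; as they are finitely many, the branch
   of [k] is eventually off all their branches. *)
have [N NP] : exists N, forall n j n', N <= n -> E j -> branch k n <> branch j n'.
  have /finite_seqP[s Es] := hE : finite_set (E : set {classic omega1}).
  have sS (j : {classic omega1}) : j \in s -> ~ S j.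
    by move=> js; apply: ES; rewrite Es.
  suff [N NP] : exists N, forall n (j : {classic omega1}) n', N <= n ->
      j \in s -> branch k n <> branch j n'.
    by exists N => n j n' Nn; rewrite Es; exact: NP.
  elim: s sS {Es} => [|j s IH] sS; first by exists 0.
  have [i si|N NP] := IH; first by apply: sS; rewrite inE si orbT.
  have [e|N' N'P] := @branch_almost_disjoint j k.
    by case: (sS j); [rewrite mem_head|rewrite e].
  exists (maxn N N') => n j' n'; rewrite geq_max => /andP[Nn N'n].
  by rewrite inE => /predU1P[->|]; [exact: N'P|exact: NP].
(* [m] is the required bound, [N] protects the promises in [E], and [size u] puts the new bit beyond
   [u]. The extension [v] pads [u] with zeros and has its only new true bit at [branch k n]. *)
pose n := maxn (maxn m N) (size u).
have un : size u <= branch k n.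
  by apply: leq_trans (ltnW (branch_gt k n)); rewrite leq_maxr.
pose v := rcons (u ++ nseq (branch k n - size u) false) true.
have sv : size (u ++ nseq (branch k n - size u) false) = branch k n.
  by rewrite size_cat size_nseq subnKC.
exists (v, exist _ E (conj hE ES)) => /=.
  exists n; first by rewrite /n !leq_max leqnn.
  by rewrite /v nth_rcons sv ltnn eqxx.
apply/asboolP; split=> //=.
  by rewrite /v -cats1 -catA prefix_prefix.
move=> i j n' ui; rewrite /v nth_rcons sv; case: ltnP => [_|_].
  by rewrite nth_cat ltnNge ui nth_nseq if_same.
case: eqP => // -> _ Ej; apply: NP => //.
by rewrite /n !leq_max leqnn orbT.
Qed.

End Forcing.

(** The real is the union of the bit strings in a filter meeting omega1 dense sets: for [k] in [S]
    they force bits arbitrarily far along the branch of [k], for other [k] they force a promise to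
    avoid it. *)
Lemma MA_hits : MA_omega1 ->
  forall S : set omega1, exists x, forall k, hits k x <-> S k.
Proof.
move=> MA S.
have [g gI] : small (omega1 + omega1 * nat).
  by apply: small_sum; [exact: small_omega1|apply: small_prod; [exact: small_omega1|exact: small_nat]].
pose D (j : omega1 + omega1 * nat) : set (condition S) :=
  match j with
  | inl k => [set p | S k \/ sval p.2 k]
  | inr (k, m) => [set p | S k -> exists2 n, m <= n & nth false p.1 (branch k n)]
  end.
have Dd j : forcing_dense (@stronger S) (D j).
  have refl := (stronger_partial_order S).1.1.
  case: j => [k|[k m]] p /=; have [Sk|nSk] := pselect (S k).
  - by exists p => //; left.
  - by have [d dk dp] := dense_avoid nSk p; exists d => //; right.
  - by have [d dk dp] := dense_hit m Sk p; exists d.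
  - by exists p.
have P0 : inhabited (condition S).
  split; have h0 : finite_set (@set0 omega1) /\ set0 `<=` ~` S by split.
  by exact: ([::], exist _ set0 h0).
have [|G [_ _ Gdir] GD] := MA _ _ P0 (stronger_partial_order S) (@stronger_ccc S)
    (* For [i] outside the range of [g] this is the set of all conditions. *)
    (fun i => [set p | forall j, g j = i -> D j p]).
  move=> i p; have [[j ji]|nj] := pselect (exists j, g j = i).
    have [d dk dp] := Dd j p; exists d => // j'; rewrite -ji => /gI-> //.
  by exists p; [move=> j ji; case: nj; exists j|exact: (stronger_partial_order S).1.1].
have {}GD j : exists2 p, G p & D j p.
  by have [p [Gp Dp]] := GD (g j); exists p => //; exact: Dp.
exists (fun i => `[< exists2 p, G p & nth false p.1 i >]) => k; split; last first.
  move=> Sk m _; have [p Gp /(_ Sk)[n mn pn]] := GD (inr (k, m)).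
  by exists n => //; apply/asboolP; exists p.
move=> H; have [p Gp [//|pk]] := GD (inl k).
(* Since [branch k n] exceeds [n], which is at least [size p.1], this bit lies beyond [p.1]; a
   common extension [r] of [p] and [q] then breaks the promise of [p]. *)
have [n /= pn /asboolP[q Gq qn]] := H (size p.1) I.
have [r [_ /asboolP[_ _ rp] /asboolP[qr _ _]]] := Gdir _ _ Gp Gq.
case: (rp (branch k n) k n) => //; last exact: nth_prefix qn.
exact: leq_trans pn (ltnW (branch_gt k n)).
Qed.

End AlmostDisjointCoding.

Lemma MA_independent_sets : MA_omega1 ->
  exists2 H : omega1 -> set cantor_space,
    (forall F, omega1_algebra F -> forall k, F (H k)) &
    forall S : set omega1, exists x, forall k, H k x <-> S k.
Proof.
move=> MA; have [f fI] := omega1_inj_sets; exists (hits f).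
  by move=> F FA k; exact: hits_omega1_algebra.
exact: MA_hits.
Qed.

(** * Bounded families in omega2 and induction on ordinals *)

Lemma small_surj (J : Type) :
  small J -> inhabited J -> exists e : omega1 -> J, forall j, exists i, e i = j.
Proof.
move=> [f fI] [j0].
have /choice[e eP] (i : omega1) : exists j, forall j', f j' = i -> j = j'.
  have [[j ji]|nj] := pselect (exists j, f j = i).
    by exists j => j'; rewrite -ji => /fI.
  by exists j0 => j' j'i; case: nj; exists j'.
by exists e => j; exists (f j); exact: eP.
Qed.

Lemma hartogs_inhabited (X : Type) : inhabited (hartogs X).
Proof.
apply: contrapT => n; apply: (hartogsP X).1; apply/card_leTT.
have e (y : hartogs X) : False by apply: n.
by exists (fun y => match e y with end) => y; case: (e y).
Qed.

(** If the family were cofinal, each [z] would be at most some [y (i z)]. Recording [i z] and the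
    place of [z] in the segment below [y (i z)], or the mark [inl tt] when they coincide, would
    inject omega2 into omega1. *)
Lemma omega2_uncofinal (y : omega1 -> omega2) :
  exists z, forall i, oinitial z (y i).
Proof.
apply: contrapT => nz.
have /choice[i iP] z : exists i, orel z (y i).
  apply: contrapT => ni; apply: nz; exists z => i.
  by apply/oinitialNge => zi; apply: ni; exists i.
have gex (w : omega2) : exists g : osegment w -> omega1, injective g.
  exact/card_leTT/(hartogsP omega1).2/osegment_olt.
pose g (w : omega2) := sval (cid (gex w)).
have gI w : injective (g w) by exact: svalP (cid (gex w)).
pose h (z : omega2) : omega1 * (unit + omega1) :=
  (i z, match pselect (oinitial (y (i z)) z) with
        | left p => inr (g _ (exist _ z p))
        | right _ => inl tt
        end).
apply: (hartogsP omega1).1; apply/card_leTT.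
apply: (@small_inj _ _ h); last first.
  apply: small_prod; first exact: small_omega1.
  by apply: small_sum; [exact: small_countType|exact: small_omega1].
have eqy z : ~ oinitial (y (i z)) z -> z = y (i z).
  by move=> n; apply: contrapT => ne; apply: n; split.
move=> z z'; rewrite /h; case: pselect => [p|n]; case: pselect => [p'|n'] [] // e.
  by move: p'; rewrite -e => p' /gI[].
by rewrite (eqy _ n) (eqy _ n') e.
Qed.

(** It replaces ordinals below [b] by points of [b], so that inductions run inside one fixed
    well-order. *)
Definition order_type_below (b : Ord) (z : b) (c : Ord) : Prop :=
  exists f : c -> b, oembedding f /\ range f = oinitial z.

Lemma order_type_below_olt (b : Ord) (z : b) (c d : Ord) :
  order_type_below z c -> olt d c ->
  exists2 y, oinitial z y & order_type_below y d.
Proof.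
move=> [f [fe fz]] [g [w [ge gw]]]; exists (f w); first by rewrite -fz; exists w.
exists (f \o g); split; first by move=> x y; rewrite /= fe ge.
rewrite predeqE => y; split.
  move=> [x _ <-] /=; apply/(oembedding_oinitial _ _ fe).
  by rewrite -gw; exists x.
move=> yw; have : range f y.
  rewrite fz; apply: oinitial_trans yw _.
  by rewrite -fz; exists w.
move=> [x _ xy]; have : oinitial w x by apply/(oembedding_oinitial _ _ fe); rewrite xy.
by rewrite -gw => -[t _ tx]; exists t; rewrite //= tx.
Qed.

Lemma order_type_below_osegment (b : Ord) (y z : b) (c : Ord) :
  order_type_below y c -> oinitial z y -> olt c (osegment z).
Proof.
move=> [f [fe fy]] zy.
have fz x : oinitial z (f x).
  by apply: (oinitial_trans _ zy); rewrite -fy; exists x.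
exists (fun x => exist _ (f x) (fz x) : osegment z), (exist _ y zy); split=> //.
rewrite predeqE => -[t tz]; split=> [[x _ <-]|[ty nty]].
  have [? n] : oinitial y (f x) by rewrite -fy; exists x.
  by split=> // -[].
have : oinitial y t by split=> // e; apply: nty; exact: eq_exist.
by rewrite -fy => -[x _ xt]; exists x => //; exact: eq_exist.
Qed.

Lemma olt_ind (P : Ord -> Prop) :
  (forall a, (forall c, olt c a -> P c) -> P a) -> forall a, P a.
Proof.
move=> IH a; apply: (IH) => c [f [z fz]]; move: c f fz.
suff H c : order_type_below z c -> P c by move=> c f fz; apply: H; exists f.
move: c; elim/oinitial_ind: z => z IHz c cz; apply: IH => d dc.
by have [y zy yd] := order_type_below_olt cz dc; exact: IHz yd.
Qed.

(** * Closure properties of the hierarchy *)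

Lemma Sigma_starE a A : Sigma_star a A ->
  ~ inhabited a /\ clopen A \/
  inhabited a /\ exists2 B : omega1 -> set cantor_space, A = \bigcup_i B i &
    forall i, exists2 c, olt c a & Pi_star c (B i).
Proof. by case=> {a A} a A; [left|right; split=> //; exists A]. Qed.

Lemma Pi_starE a A : Pi_star a A ->
  ~ inhabited a /\ clopen A \/
  inhabited a /\ exists2 B : omega1 -> set cantor_space, A = \bigcap_i B i &
    forall i, exists2 c, olt c a & Sigma_star c (B i).
Proof. by case=> {a A} a A; [left|right; split=> //; exists A]. Qed.

Lemma star_setC a : forall A,
  (Sigma_star a A -> Pi_star a (~` A)) /\ (Pi_star a A -> Sigma_star a (~` A)).
Proof.
elim/olt_ind: a => a IH A; split.
  case/Sigma_starE=> [[na Ac]|[ha [B -> BP]]]; first by constructor => //; exact: clopenC.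
  rewrite setC_bigcup; apply: Pi_star_bigcap => // i.
  by have [c ca /(IH c ca (B i)).2] := BP i; exists c.
case/Pi_starE=> [[na Ac]|[ha [B -> BP]]]; first by constructor => //; exact: clopenC.
rewrite setC_bigcap; apply: Sigma_star_bigcup => // i.
by have [c ca /(IH c ca (B i)).1] := BP i; exists c.
Qed.

Lemma olt_zero (a : Ord) : inhabited a -> exists2 c, olt c a & ~ inhabited c.
Proof.
move=> [x]; have [|m _ mP] := @wo_min _ _ (@orelP a) setT; first by exists x.
exists (osegment m); first exact: osegment_olt.
by move=> [[y /oinitialNge]]; apply; exact: mP.
Qed.

Lemma Sigma_star_clopen (a : Ord) A : inhabited a -> clopen A -> Sigma_star a A.
Proof.
move=> ha Ac; have [c ca nc] := olt_zero ha.
have [i0] := hartogs_inhabited nat.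
have -> : A = \bigcup_(i : omega1) A by rewrite bigcup_const //; exists i0.
by apply: Sigma_star_bigcup => // _; exists c => //; constructor.
Qed.

(** A union of omega1 unions is re-enumerated by omega1, through a surjection onto
    [omega1 * omega1]. *)
Lemma Sigma_star_bigcupT (a : Ord) (A : omega1 -> set cantor_space) :
  inhabited a -> (forall i, Sigma_star a (A i)) -> Sigma_star a (\bigcup_i A i).
Proof.
move=> ha AS.
have /choice[B BP] i : exists B : omega1 -> set cantor_space, A i = \bigcup_j B j /\
    forall j, exists2 c, olt c a & Pi_star c (B j).
  by have [[//]|[_ [B ? ?]]] := Sigma_starE (AS i); exists B.
have [i0] := hartogs_inhabited nat.
have [e eS] := small_surj omega1_prod (inhabits (i0, i0)).
have -> : \bigcup_i A i = \bigcup_i B (e i).1 (e i).2.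
  rewrite predeqE => x; split=> [[i _]|[i _ Bx]].
    by rewrite (BP i).1 => -[j _ Bx]; have [k kij] := eS (i, j); exists k; rewrite ?kij.
  by exists (e i).1 => //; rewrite (BP _).1; exists (e i).2.
by apply: Sigma_star_bigcup => // i; exact: (BP _).2.
Qed.

(** Complementation exchanges the two classes, so their equality gives closure under complements. *)
Lemma collapse_omega1_algebra (a : Ord) :
  inhabited a -> Pi_star a = Sigma_star a -> omega1_algebra (Sigma_star a).
Proof.
move=> ha PS; split.
- by move=> A; exact: Sigma_star_clopen.
- by move=> A /(star_setC a A).1; rewrite PS.
- by move=> A; exact: Sigma_star_bigcupT.
Qed.

(** * Universal sets *)

(** Written as an intersection over all of [nat], so that closure under small intersections applies
    directly. *)
Definition cylinder (s : seq bool) : set cantor_space :=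
  \bigcap_i [set x | i < size s -> x i = nth false s i].

Lemma cylinder_omega1_algebra F s : omega1_algebra F -> F (cylinder s).
Proof.
move=> FA; apply: omega1_algebra_bigcap => //; first exact: small_nat.
move=> i; have [Fclopen FC _] := FA.
have [lti|gei] := ltnP i (size s); last first.
  suff -> : [set x : cantor_space | false -> x i = nth false s i] = setT.
    exact/Fclopen/clopenT.
  by rewrite predeqE.
case: (nth false s i).
  suff -> : [set x : cantor_space | true -> x i = true] = [set x : cantor_space | x i].
    exact/Fclopen/clopen_coordinate.
  by rewrite predeqE => x /=; split=> [/(_ isT)->//|->].
suff -> : [set x : cantor_space | true -> x i = false] = ~` [set x : cantor_space | x i].
  exact/FC/Fclopen/clopen_coordinate.
by rewrite predeqE => x /=; split=> [/(_ isT)->//|/negP/negbTE].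
Qed.

Lemma open_bigcup_cylinder (A : set cantor_space) :
  open A -> A = \bigcup_(s in [set s | cylinder s `<=` A]) cylinder s.
Proof.
move=> oA; rewrite predeqE => x; split=> [Ax|[s sA xs]]; last exact: sA.
have [N NP] := open_cylinder oA Ax; exists (mkseq x N).
  move=> y xy; apply: NP => i iN.
  by rewrite (xy i I) ?size_mkseq // nth_mkseq.
by move=> i _; rewrite /= size_mkseq => iN; rewrite nth_mkseq.
Qed.

(* [V] parametrizes by subsets of [omega1] the sets of multiplicative class [c],
   for [c] the order type of the segment below [z], and the parametrization is
   omega1-Borel in the parameter. *)
Record universal (z : omega2) (V : set omega1 -> set cantor_space) : Prop :=
  Universal {
    universal0 : V set0 = set0;
    universal_surj : forall c A, order_type_below z c -> Pi_star c A ->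
      exists l, V l = A;
    universal_omega1_algebra : forall F, omega1_algebra F ->
      forall lam : cantor_space -> set omega1,
      (forall k, F [set x | lam x k]) -> F [set x | V (lam x) x]
  }.

(** Induction on [z]. A parameter codes an open set, as a set of bit strings, and omega1 parameters
    for each smaller [w]; the set it names is the open set minus all the sets so named. Below a
    point of omega2 there are at most omega1 such [w], so one subset of omega1 holds all this. *)
Lemma universal_ex (z : omega2) : exists V, universal z V.
Proof.
elim/oinitial_ind: z => z IH.
have /choice[V VP] (w : osegment z) : exists V, universal (sval w) V.
  exact: IH (svalP w).
have zs : small (osegment z) by exact/card_leTT/(hartogsP omega1).2/osegment_olt.
pose J : Type := osegment z * omega1.
have Js : small J by apply: small_prod => //; exact: small_omega1.
have [g gI] : small (seq bool + J * omega1).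
  apply: small_sum; first exact: small_countType.
  by apply: small_prod => //; exact: small_omega1.
pose W (l : set omega1) : set cantor_space :=
  (\bigcup_(s in [set s | l (g (inl s))]) cylinder s) `&`
  \bigcap_(p : J) ~` V p.1 [set j | l (g (inr (p, j)))].
(* By injectivity of [g], the open part and the smaller parameters can be prescribed
   independently. *)
have WP (L : set (seq bool)) (m : J -> set omega1) : exists l,
    W l = (\bigcup_(s in L) cylinder s) `&` \bigcap_p ~` V p.1 (m p).
  exists [set k | (exists2 s, g (inl s) = k & L s) \/
                  (exists2 q, g (inr q) = k & m q.1 q.2)].
  congr (_ `&` _).
    congr (\bigcup_(s in _) _); rewrite predeqE => s; split=> [|Ls].
      by case=> -[q /gI] // [->].
    by left; exists s.
  apply: eq_bigcapr => p _; congr (~` V _ _); rewrite predeqE => j; split=> [|mj].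
    by case=> -[q /gI] // [->].
  by right; exists (p, j).
exists W; split.
(* The empty parameter names no cylinder, so the open part is empty. *)
- by rewrite /W; apply/seteqP; split=> // x [[]].
- move=> c A cz /Pi_starE[[_ [oA _]]|[_ [B -> BP]]].
    (* Level zero: the open part is [A], and empty parameters remove nothing. *)
    have [l Wl] := WP [set s | cylinder s `<=` A] (fun=> set0).
    exists l; rewrite Wl -open_bigcup_cylinder //.
    rewrite [X in _ `&` X](_ : _ = setT) ?setIT // predeqE => x; split=> // _ p _.
    by rewrite (universal0 (VP p.1)).
  have /choice[y /choice[l yl]] i : exists (w : osegment z) l, V w l = ~` B i.
    have [d dc /(star_setC d _).1 Bd] := BP i.
    have [y zy yd] := order_type_below_olt cz dc.
    have [l Vl] := universal_surj (VP (exist _ y zy)) yd Bd.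
    by exists (exist _ y zy), l.
  (* At index [i] only the level [y i] gets a parameter, namely the one naming the complement of
     [B i]; other levels get the empty parameter and remove nothing. The open part is the whole
     space, through the empty string. *)
  have [l' Wl] := WP setT (fun p => [set j | p.1 = y p.2 /\ l p.2 j]).
  exists l'; rewrite Wl predeqE => x; split=> [[_ xV] i _|xB].
    have := xV (y i, i) I => /=.
    rewrite (_ : [set j | _ ] = l i); first by rewrite yl => /contrapT.
    by rewrite predeqE => j; split=> [[]|].
  split; first by exists [::].
  move=> [w i] _ /=; have [->|nw] := pselect (w = y i).
    rewrite (_ : [set j | _ ] = l i); first by rewrite yl => nB; apply/nB/xB.
    by rewrite predeqE => j; split=> [[]|].
  rewrite (_ : [set j | _ ] = set0); first by rewrite (universal0 (VP w)).
  by rewrite predeqE => j; split=> // -[].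
(* The smaller parameters are sections of [lam x] and still vary with [x], so the induction
   hypothesis is applied to the functions sending [x] to such a section. *)
- move=> F FA lam lamF; have [_ FC _] := FA.
  rewrite (_ : [set x | _] =
    (\bigcup_s ([set x | lam x (g (inl s))] `&` cylinder s)) `&`
    \bigcap_(p : J) ~` [set x | V p.1 [set j | lam x (g (inr (p, j)))] x]).
    apply: omega1_algebra_setI => //.
      apply: omega1_algebra_bigcup => //; first exact: small_countType.
      move=> s; apply: omega1_algebra_setI => //; exact: cylinder_omega1_algebra.
    apply: omega1_algebra_bigcap => // p; apply: FC.
    by apply: (universal_omega1_algebra (VP p.1)) => // k; exact: lamF.
  rewrite predeqE => x; split=> -[[s sl xs] xV]; split=> //; first by exists s.
  by case: xs => ? ?; exists s.
Qed.

(** * Diagonalization and the length of the hierarchy *)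

Lemma hierarchy_no_collapse : MA_omega1 ->
  forall a : Ord, inhabited a -> olt a omega2 -> Pi_star a <> Sigma_star a.
Proof.
move=> MA a ha [f [z fz]] PS; have FA := collapse_omega1_algebra ha PS.
have [H HF HS] := MA_independent_sets MA; have [V VP] := universal_ex z.
(* Each real is tested against the set named by the parameter that it codes itself. *)
pose D := [set x | V [set k | H k x] x].
have /(star_setC a _).1 DC : Sigma_star a D.
  by apply: (universal_omega1_algebra VP) => // k; exact: HF.
have [|l Vl] := universal_surj VP _ DC; first by exists f.
(* A real coding the parameter of the complement of [D] gives the contradiction. *)
have [x xl] := HS l.
have Dx : D x <-> (~` D) x.
  rewrite -Vl /D /= (_ : [set k | H k x] = l) // predeqE => k; exact: xl.
have nDx : ~ D x by move=> /[dup] /Dx.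
exact/nDx/Dx.
Qed.

(** The levels of the omega1 pieces are bounded by some [z] below omega2, so the union already
    appears at the level of the segment below [z], and a constant intersection puts it in the dual
    class. *)
Lemma Sigma_star_omega2 A : Sigma_star omega2 A -> Pi_star omega2 A.
Proof.
have [i0] := hartogs_inhabited nat; have h2 := hartogs_inhabited omega1.
case/Sigma_starE=> [[//]|[_ [B -> BP]]].
have /choice[y yP] i : exists y : omega2, exists2 c, order_type_below y c & Pi_star c (B i).
  by have [c [f [y fy]] Bc] := BP i; exists y, c => //; exists f.
have [z zP] := omega2_uncofinal y.
have -> : \bigcup_i B i = \bigcap_(j : omega1) \bigcup_i B i.
  by rewrite bigcap_const //; exists i0.
apply: Pi_star_bigcap => // _; exists (osegment z); first exact: osegment_olt.
apply: Sigma_star_bigcup => [|i]; first by split; exact: (exist _ _ (zP i0)).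
by have [c yc Bc] := yP i; exists c => //; exact: order_type_below_osegment yc (zP i).
Qed.

Theorem theorem2 :
  MA_omega1 ->
  (forall a : Ord, inhabited a -> olt a omega2 ->
     Pi_star a <> Sigma_star a) /\
  hierarchy_length omega2.
Proof.
move=> MA; have nocollapse := hierarchy_no_collapse MA; split=> //; split.
- exact: hartogs_inhabited.
- rewrite predeqE => A; split; last exact: Sigma_star_omega2.
  (* The converse inclusion is obtained by passing to complements twice. *)
  move=> /(star_setC _ _).2/Sigma_star_omega2/(star_setC _ _).2.
  by rewrite setCK.
- by move=> a ha PS; have [/(nocollapse a ha)|] := olt_or_ole a omega2.
Qed.
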